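(* Let $r\ge1$ and let $G_r(t,u,v,z)=\sum_w t^{\mathrm{length}(w)}u^{\mathrm{asc}(w)}v^{\mathrm{last}(w)}z^{\mathrm{zeros}(w)}$, summed over all ascent sequences $w=(x_1,\dots,x_n)$ with $n\ge r+1$, $x_1=\dots=x_r=0$ and $x_{r+1}=1$. For $s\ge 1$ put $\delta_s=u-(1-t)^s(u-1)$, $\gamma_s=u-(1-zt)(1-t)^{s-1}(u-1)$, $\bar\delta_s=uv-(1-t)^s(uv-1)$, $\bar\gamma_s=uv-(1-zt)(1-t)^{s-1}(uv-1)$, and $\delta_0=\gamma_0=\bar\delta_0=\bar\gamma_0=1$. Then $$G_r(t,u,v,z)=\frac{t^{r+1}z^ru}{v\delta_1-1}\Big(v(v-1)+t(1-u)(z(v-1)-v)\sum_{s\ge0}\frac{u^s(1-t)^s}{\delta_s\delta_{s+1}\prod_{i=1}^{s+1}\gamma_i}+uv^3t(1-uv)\sum_{s\ge0}\frac{(uv)^s(1-t)^s}{\bar\delta_s\bar\delta_{s+1}\prod_{i=1}^{s+1}\bar\gamma_i}\Big).$$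
   Context: An ascent sequence of length $n$ is a sequence $(x_1,\dots,x_n)$ of nonnegative integers with $x_1=0$ and $x_i\in[0,1+\mathrm{asc}(x_1,\dots,x_{i-1})]$ for $2\le i\le n$, where $\mathrm{asc}(y_1,\dots,y_k)=|\{1\le j<k: y_j<y_{j+1}\}|$. For an ascent sequence $w$: $\mathrm{length}(w)$ is its number of entries, $\mathrm{asc}(w)$ its number of ascents, $\mathrm{last}(w)$ its rightmost entry, and $\mathrm{zeros}(w)$ its number of entries equal to 0. Identities are of formal power series in $t,u,v,z$ over $\mathbb{Q}$; $v\delta_1-1$ has constant term $-1$ and each $\delta_s,\gamma_s,\bar\delta_s,\bar\gamma_s$ has constant term $1$, so all quotients are formal power series, and the $s$-th summands are divisible by $u^s$, so the sums converge formally. *)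

(* Defs.v *)
From HB Require Import structures.
From mathcomp Require Import all_boot all_order all_algebra.
Set Implicit Arguments. Unset Strict Implicit. Unset Printing Implicit Defensive.
Import Order.TTheory GRing.Theory Num.Theory.
Local Open Scope ring_scope.

(** ** Formal power series in four variables t,u,v,z over Q.
    [f i j k l] is the coefficient of t^i u^j v^k z^l. *)
Definition fps := nat -> nat -> nat -> nat -> rat.

Definition fC (c : rat) : fps := fun i j k l =>
  if [&& i == 0%N, j == 0%N, k == 0%N & l == 0%N] then c else 0.
Definition fT : fps := fun i j k l =>
  if [&& i == 1%N, j == 0%N, k == 0%N & l == 0%N] then 1 else 0.
Definition fU : fps := fun i j k l =>
  if [&& i == 0%N, j == 1%N, k == 0%N & l == 0%N] then 1 else 0.
Definition fV : fps := fun i j k l =>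
  if [&& i == 0%N, j == 0%N, k == 1%N & l == 0%N] then 1 else 0.
Definition fZ : fps := fun i j k l =>
  if [&& i == 0%N, j == 0%N, k == 0%N & l == 1%N] then 1 else 0.

Definition fadd (f g : fps) : fps := fun i j k l => f i j k l + g i j k l.
Definition fopp (f : fps) : fps := fun i j k l => - f i j k l.
Definition fsub (f g : fps) : fps := fadd f (fopp g).
Definition fscale (c : rat) (f : fps) : fps := fun i j k l => c * f i j k l.

Definition fmul (f g : fps) : fps := fun i j k l =>
  \sum_(a < i.+1) \sum_(b < j.+1) \sum_(c < k.+1) \sum_(d < l.+1)
     f a b c d * g (i - a)%N (j - b)%N (k - c)%N (l - d)%N.

Definition fexp (f : fps) (n : nat) : fps := iter n (fmul f) (fC 1).

(** Multiplicative inverse of a series with nonzero constant term c: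
    1/f = c^-1 * sum_{m>=0} h^m with h = 1 - f/c (h has zero constant term,
    so h^m contributes only to monomials of total degree >= m). *)
Definition finv (f : fps) : fps :=
  let c := f 0%N 0%N 0%N 0%N in
  let h := fsub (fC 1) (fscale c^-1 f) in
  fun i j k l => c^-1 * \sum_(m < (i + j + k + l).+1) fexp h m i j k l.

Definition fdiv (f g : fps) : fps := fmul f (finv g).

Definition fprod (F : nat -> fps) (a n : nat) : fps :=
  foldr (fun i acc => fmul (F i) acc) (fC 1) (iota a n).

Definition fsum_to (A : nat -> fps) (S : fps) : Prop :=
  forall i j k l, exists N : nat, forall n : nat, (N <= n)%N ->
    \sum_(s < n) A s i j k l = S i j k l.

Definition asc (s : seq nat) : nat :=
  count (fun p : nat * nat => (p.1 < p.2)%N) (zip s (behead s)).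

Definition is_ascent (s : seq nat) : bool :=
  [&& s != [::], nth 0%N s 0 == 0%N &
      all (fun i => (nth 0%N s i <= (asc (take i s)).+1)%N) (iota 1 (size s).-1)].

Definition zeros (s : seq nat) : nat := count_mem 0%N s.

Definition Gpred (r : nat) (s : seq nat) (a b c : nat) : bool :=
  [&& is_ascent s, (r < size s)%N,
      all (fun i => nth 0%N s i == 0%N) (iota 0 r),
      nth 0%N s r == 1%N, asc s == a, last 0%N s == b & zeros s == c].

(** Every entry of an ascent sequence of length n is < n (x_i <= i-1), so the
    ascent sequences of length n are found among n-tuples over 'I_n. *)
Definition Gcoef (r n a b c : nat) : nat :=
  #|[set w : n.-tuple 'I_n | Gpred r (map (@nat_of_ord n) w) a b c]|.

Definition G (r : nat) : fps := fun n a b c => (Gcoef r n a b c)%:R.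

Definition fone := fC 1.
Definition delta (s : nat) : fps :=
  if s is 0%N then fone else
  fsub fU (fmul (fexp (fsub fone fT) s) (fsub fU fone)).
Definition gamma (s : nat) : fps :=
  if s is 0%N then fone else
  fsub fU (fmul (fmul (fsub fone (fmul fZ fT)) (fexp (fsub fone fT) s.-1))
                (fsub fU fone)).
Definition dbar (s : nat) : fps :=
  if s is 0%N then fone else
  fsub (fmul fU fV) (fmul (fexp (fsub fone fT) s) (fsub (fmul fU fV) fone)).
Definition gbar (s : nat) : fps :=
  if s is 0%N then fone else
  fsub (fmul fU fV)
    (fmul (fmul (fsub fone (fmul fZ fT)) (fexp (fsub fone fT) s.-1))
          (fsub (fmul fU fV) fone)).

Definition termA (s : nat) : fps :=
  fdiv (fmul (fexp fU s) (fexp (fsub fone fT) s))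
       (fmul (fmul (delta s) (delta s.+1)) (fprod gamma 1 s.+1)).
Definition termB (s : nat) : fps :=
  fdiv (fmul (fexp (fmul fU fV) s) (fexp (fsub fone fT) s))
       (fmul (fmul (dbar s) (dbar s.+1)) (fprod gbar 1 s.+1)).

Definition Grhs (r : nat) (S1 S2 : fps) : fps :=
  fmul
    (fdiv (fmul (fmul (fexp fT r.+1) (fexp fZ r)) fU)
          (fsub (fmul fV (delta 1)) fone))
    (fadd (fadd (fmul fV (fsub fV fone))
                (fmul (fmul (fmul fT (fsub fone fU))
                            (fsub (fmul fZ (fsub fV fone)) fV)) S1))
          (fmul (fmul (fmul (fmul fU (fexp fV 3)) fT) (fsub fone (fmul fU fV))) S2)).

(* Main.v *)
Require Import Defs.
From HB Require Import structures.
From mathcomp Require Import all_boot all_order all_algebra.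
From mathcomp Require Import boolp.
From mathcomp Require Import ring zify.
Set Implicit Arguments. Unset Strict Implicit. Unset Printing Implicit Defensive.
Import Order.TTheory GRing.Theory Num.Theory.
Local Open Scope ring_scope.

(** Appending a letter to a sequence with a ascents and last entry b
    gives, by summing geometric series in v, the functional equation
      (v delta_1 - 1) G(u,v) = t^(r+1) z^r u v (v-1)
         + t (z(v-1) - v) G(u,1) + t u v^2 G(uv,1),
    so only G(y,1) for y = u and y = uv is needed.  The equation holds in every
    commutative ring (up to a multiple of t^n when lengths are bounded), so
    instead of composing series we evaluate it, inside the ring of power series,
    at u = y / delta_s, v = delta_s / delta_(s+1), where the left-hand side
    vanishes and uv = y / delta_(s+1).  This relates G(y/delta_s, 1) to
    G(y/delta_(s+1), 1) with a factor y; iterating from s = 0 produces the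
    partial sums of the series, with an error divisible by y^n or t^n. *)

(** * The ring of power series *)

(** Used with [x] the candidate inverse of [c * (1 - h)]: its defect splits into that of a partial
    geometric sum and a power of [h], both of high order. *)
Lemma geom_inverse (A : comNzRingType) (c d h x : A) n : d * c = 1 ->
  x * (c * (1 - h)) - 1 =
  (x - d * \sum_(m < n) h ^+ m) * (c * (1 - h)) - h ^+ n.
Proof.
move=> dc; set s := \sum_(m < n) _.
have hs : (1 - h) * s = 1 - h ^+ n by rewrite -opprB mulNr -subrX1 opprB.
have -> : (x - d * s) * (c * (1 - h)) - h ^+ n =
          x * (c * (1 - h)) - d * c * ((1 - h) * s) - h ^+ n by ring.
by rewrite hs dc; ring.
Qed.

Lemma fpsP (f g : fps) : (forall i j k l, f i j k l = g i j k l) -> f = g.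
Proof.
move=> fg; apply/funext => i; apply/funext => j; apply/funext => k.
by apply/funext => l.
Qed.

(* A morphism from iterated polynomials; since a coefficient of a product only
   depends on truncations, the ring axioms of fps are inherited through it. *)
Definition coef4 (p : {poly {poly {poly {poly rat}}}}) : fps :=
  fun i j k l => p`_i`_j`_k`_l.

Lemma coef4M p q : coef4 (p * q) = fmul (coef4 p) (coef4 q).
Proof.
apply: fpsP => i j k l; rewrite /coef4 /fmul coefM !coef_sum.
apply: eq_bigr => a _; rewrite coefM !coef_sum; apply: eq_bigr => b _.
rewrite coefM !coef_sum; apply: eq_bigr => c _; rewrite coefM.
by apply: eq_bigr.
Qed.

Lemma coef4C (c : rat) : coef4 (c%:P%:P%:P%:P) = fC c.
Proof.
apply: fpsP => i j k l; rewrite /coef4 /fC coefC.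
case: (i == _); last by rewrite !coef0.
rewrite coefC; case: (j == _); last by rewrite !coef0.
by rewrite coefC; case: (k == _); rewrite ?coef0 // coefC.
Qed.

Lemma coef4_1 : coef4 1 = fC 1.
Proof.
apply: fpsP => i j k l; rewrite /coef4 /fC coef1.
case: (i == _); last by rewrite mulr0n !coef0.
rewrite mulr1n coef1; case: (j == _); last by rewrite mulr0n !coef0.
rewrite mulr1n coef1; case: (k == _); last by rewrite mulr0n coef0.
by rewrite mulr1n coef1; case: (l == _).
Qed.

Definition trunc4 (n : nat) (f : fps) : {poly {poly {poly {poly rat}}}} :=
  \poly_(i < n) \poly_(j < n) \poly_(k < n) \poly_(l < n) f i j k l.

Lemma coef4_trunc4 n f i j k l : (i < n)%N -> (j < n)%N -> (k < n)%N ->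
  (l < n)%N -> coef4 (trunc4 n f) i j k l = f i j k l.
Proof.
by move=> hi hj hk hl; rewrite /coef4 /trunc4 coef_poly hi coef_poly hj
  coef_poly hk coef_poly hl.
Qed.

Lemma eq_fmul f f' g g' i j k l :
  (forall a b c d, (a <= i)%N -> (b <= j)%N -> (c <= k)%N -> (d <= l)%N ->
     f a b c d = f' a b c d) ->
  (forall a b c d, (a <= i)%N -> (b <= j)%N -> (c <= k)%N -> (d <= l)%N ->
     g a b c d = g' a b c d) ->
  fmul f g i j k l = fmul f' g' i j k l.
Proof.
move=> ff gg; rewrite /fmul; apply: eq_bigr => a _; apply: eq_bigr => b _.
apply: eq_bigr => c _; apply: eq_bigr => d _.
by rewrite ff ?gg ?leq_subr // -ltnS ltn_ord.
Qed.

Lemma fmul_trunc4 n f g i j k l :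
  (i < n)%N -> (j < n)%N -> (k < n)%N -> (l < n)%N ->
  fmul f g i j k l = coef4 (trunc4 n f * trunc4 n g) i j k l.
Proof.
move=> hi hj hk hl; rewrite coef4M; apply: eq_fmul => a b c d la lb lc ld;
by rewrite coef4_trunc4 //; [apply: leq_ltn_trans la _|
  apply: leq_ltn_trans lb _|apply: leq_ltn_trans lc _|
  apply: leq_ltn_trans ld _].
Qed.

Lemma fmulC : commutative fmul.
Proof.
move=> f g; apply: fpsP => i j k l.
by rewrite !(@fmul_trunc4 (i + j + k + l).+1) 1?mulrC //; lia.
Qed.

Lemma fmulA : associative fmul.
Proof.
move=> f g h; apply: fpsP => i j k l; set n := (i + j + k + l).+1.
pose p := trunc4 n f; pose q := trunc4 n g; pose s := trunc4 n h.
have -> : fmul f (fmul g h) i j k l = coef4 (p * (q * s)) i j k l.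
  rewrite !coef4M; apply: eq_fmul => a b c d la lb lc ld.
    by rewrite coef4_trunc4 //; lia.
  by rewrite (@fmul_trunc4 n) ?coef4M //; lia.
have -> : fmul (fmul f g) h i j k l = coef4 (p * q * s) i j k l.
  rewrite !coef4M; apply: eq_fmul => a b c d la lb lc ld.
    by rewrite (@fmul_trunc4 n) ?coef4M //; lia.
  by rewrite coef4_trunc4 //; lia.
by rewrite mulrA.
Qed.

Lemma fmul1f : left_id (fC 1) fmul.
Proof.
move=> f; apply: fpsP => i j k l; set n := (i + j + k + l).+1.
have [hi hj hk hl] : [/\ i < n, j < n, k < n & l < n]%N by rewrite /n; split; lia.
rewrite -[RHS](@coef4_trunc4 n) //.
rewrite -[trunc4 n f]mul1r coef4M -coef4_1.
by apply: eq_fmul => a b c d la lb lc ld //; rewrite coef4_trunc4 //; lia.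
Qed.

Lemma fmulDl : left_distributive fmul fadd.
Proof.
move=> f g h; apply: fpsP => i j k l; rewrite /fmul /fadd -big_split.
apply: eq_bigr => a _; rewrite -big_split; apply: eq_bigr => b _.
rewrite -big_split; apply: eq_bigr => c _; rewrite -big_split.
by apply: eq_bigr => d _; rewrite mulrDl.
Qed.

Lemma faddA : associative fadd.
Proof. by move=> f g h; apply: fpsP => i j k l; apply: addrA. Qed.

Lemma faddC : commutative fadd.
Proof. by move=> f g; apply: fpsP => i j k l; apply: addrC. Qed.

Lemma fadd0f : left_id (fC 0) fadd.
Proof.
by move=> f; apply: fpsP => i j k l; rewrite /fadd /fC if_same add0r.
Qed.

Lemma faddNf : left_inverse (fC 0) fopp fadd.
Proof.
by move=> f; apply: fpsP => i j k l; rewrite /fadd /fopp /fC if_same addNr.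
Qed.

HB.instance Definition _ := gen_eqMixin fps.
HB.instance Definition _ := gen_choiceMixin fps.
HB.instance Definition _ := GRing.isZmodule.Build fps faddA faddC fadd0f faddNf.
Lemma fC1_neq0 : fC 1 != 0 :> fps.
Proof. by apply/eqP => /(congr1 (fun f : fps => f 0%N 0%N 0%N 0%N)). Qed.

HB.instance Definition _ := GRing.Zmodule_isComNzRing.Build fps
  fmulA fmulC fmul1f fmulDl fC1_neq0.

Lemma faddE (f g : fps) : fadd f g = f + g. Proof. by []. Qed.
Lemma fmulE (f g : fps) : fmul f g = f * g. Proof. by []. Qed.
Lemma fsubE (f g : fps) : fsub f g = f - g. Proof. by []. Qed.
Lemma foneE : fone = 1. Proof. by []. Qed.
Lemma fexpE f n : fexp f n = f ^+ n.
Proof. by elim: n => //= n IHn; rewrite exprS -IHn. Qed.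

Lemma coef_fpsD (f g : fps) i j k l :
  (f + g) i j k l = f i j k l + g i j k l.
Proof. by []. Qed.

Lemma coef_fpsN (f : fps) i j k l : (- f) i j k l = - f i j k l.
Proof. by []. Qed.

Lemma coef_fps0 i j k l : (0 : fps) i j k l = 0.
Proof. by rewrite [LHS]if_same. Qed.

Lemma coef_fps_sum (I : Type) (s : seq I) (P : pred I) (F : I -> fps) i j k l :
  (\sum_(x <- s | P x) F x) i j k l = \sum_(x <- s | P x) F x i j k l.
Proof.
apply: (big_rec2 (fun (f : fps) c => f i j k l = c)); first exact: coef_fps0.
by move=> x f c _ <-.
Qed.

(** * The filtration by total degree, and inverses *)

Definition ford (n : nat) (f : fps) : Prop :=
  forall i j k l, (i + j + k + l < n)%N -> f i j k l = 0.

Lemma ford0 f : ford 0 f. Proof. by []. Qed.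

Lemma fordD n f g : ford n f -> ford n g -> ford n (f + g).
Proof. by move=> hf hg i j k l h; rewrite coef_fpsD hf ?hg ?addr0. Qed.

Lemma fordN n f : ford n f -> ford n (- f).
Proof. by move=> hf i j k l h; rewrite coef_fpsN hf ?oppr0. Qed.

Lemma fordM m n f g : ford m f -> ford n g -> ford (m + n) (f * g).
Proof.
move=> hf hg i j k l h; rewrite -fmulE /fmul.
apply: big1 => a _; apply: big1 => b _; apply: big1 => c _; apply: big1 => d _.
have [h1|h1] := ltnP (a + b + c + d) m; first by rewrite hf ?mul0r.
rewrite hg ?mulr0 //.
have := ltn_ord a; have := ltn_ord b; have := ltn_ord c; have := ltn_ord d; lia.
Qed.

Lemma fordMr n f g : ford n f -> ford n (f * g).
Proof. by move=> hf; rewrite -[n]addn0; apply: fordM. Qed.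

Lemma fordX (f : fps) n : ford 1 f -> ford n (f ^+ n).
Proof.
by move=> hf; elim: n => [|n IHn]; [exact: ford0|rewrite exprS; apply: (fordM hf)].
Qed.

(** The filtration is separated, so identities between infinite sums can be checked up to order [n]
    with finite sums only. *)
Lemma eq_ford (f g : fps) : (forall n, ford n (f - g)) -> f = g.
Proof.
move=> h; apply: fpsP => i j k l; apply/eqP; rewrite -subr_eq0.
by rewrite -coef_fpsN -coef_fpsD (h (i + j + k + l).+1).
Qed.

Lemma coef_fCM c (g : fps) i j k l : (fC c * g) i j k l = c * g i j k l.
Proof.
set n := (i + j + k + l).+1.
have [hi hj hk hl] : [/\ i < n, j < n, k < n & l < n]%N by rewrite /n; split; lia.
have -> : (fC c * g) i j k l = coef4 (c%:P%:P%:P%:P * trunc4 n g) i j k l.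
  rewrite coef4M coef4C; apply: eq_fmul => a b x d la lb lc ld //.
  by rewrite coef4_trunc4 //; lia.
by rewrite /coef4 !coefCM -[g i j k l](@coef4_trunc4 n).
Qed.

(** With [f = c * (1 - h)] and [h] of order 1, [finv f] agrees up to order [n] with the geometric
    sum of [n] terms divided by [c]. *)
Lemma fps_mulVf (f : fps) : f 0%N 0%N 0%N 0%N != 0 -> Defs.finv f * f = 1.
Proof.
set c := f _ _ _ _ => c0.
pose h := fsub (fC 1) (fscale c^-1 f).
have h1 : ford 1 h.
  move=> [|//] [|//] [|//] [|//] _.
  by rewrite /h /fsub /fadd /fopp /fscale /= -/c mulVf // /fC /= subrr.
have fE : f = fC c * (1 - h).
  rewrite /h fsubE subKr; apply: fpsP => i j k l.
  by rewrite coef_fCM mulVKf.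
have cc : fC c^-1 * fC c = 1.
  rewrite -!coef4C -fmulE -coef4M -!polyCM mulVf // coef4C //.
apply: eq_ford => n.
suff hI : ford n (Defs.finv f - fC c^-1 * \sum_(m < n) h ^+ m).
  rewrite [X in _ * X]fE (@geom_inverse _ _ _ _ _ n cc) -fE.
  by apply: fordD; [apply: fordMr|apply/fordN/fordX].
move=> i j k l hn; rewrite coef_fpsD coef_fpsN coef_fCM coef_fps_sum.
rewrite /Defs.finv -/c -/h.
under eq_bigr do rewrite fexpE.
(* [finv] stops its sum at the total degree of the monomial; the further powers of [h] have higher
   order and vanish there. *)
rewrite (big_ord_widen n (fun m => (h ^+ m) i j k l)) //.
rewrite [X in _ - _ * X](bigID (fun m : 'I_n => (m < (i + j + k + l).+1)%N)) /=.
rewrite [X in _ - _ * (_ + X)]big1 ?addr0 ?subrr // => m.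
rewrite -ltnNge ltnS => hm; exact: fordX hm.
Qed.

(** * Coefficients of monomials *)

Lemma coef4X p m : coef4 (p ^+ m) = coef4 p ^+ m.
Proof.
elim: m => [|m IHm]; first by rewrite !expr0 coef4_1.
by rewrite !exprS coef4M IHm.
Qed.

Lemma fT_coef4 : fT = coef4 'X.
Proof.
apply: fpsP => a b c d; rewrite /coef4 /fT coefX.
case: (a == _); last by rewrite mulr0n !coef0.
rewrite mulr1n coef1; case: (b == _); last by rewrite mulr0n !coef0.
rewrite mulr1n coef1; case: (c == _); last by rewrite mulr0n coef0.
by rewrite mulr1n coef1; case: (d == _).
Qed.

Lemma fU_coef4 : fU = coef4 'X%:P.
Proof.
apply: fpsP => a b c d; rewrite /coef4 /fU coefC.
case: (a == _); last by rewrite !coef0.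
rewrite coefX; case: (b == _); last by rewrite mulr0n !coef0.
rewrite mulr1n coef1; case: (c == _); last by rewrite mulr0n coef0.
by rewrite mulr1n coef1; case: (d == _).
Qed.

Lemma fV_coef4 : fV = coef4 'X%:P%:P.
Proof.
apply: fpsP => a b c d; rewrite /coef4 /fV coefC.
case: (a == _); last by rewrite !coef0.
rewrite coefC; case: (b == _); last by rewrite !coef0.
rewrite coefX; case: (c == _); last by rewrite mulr0n coef0.
by rewrite mulr1n coef1; case: (d == _).
Qed.

Lemma fZ_coef4 : fZ = coef4 'X%:P%:P%:P.
Proof.
apply: fpsP => a b c d; rewrite /coef4 /fZ coefC.
case: (a == _); last by rewrite !coef0.
rewrite coefC; case: (b == _); last by rewrite !coef0.
rewrite coefC; case: (c == _); last by rewrite coef0.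
by rewrite coefX; case: (d == _).
Qed.

Lemma coef_monom i j k l a b c d :
  (fT ^+ i * fU ^+ j * fV ^+ k * fZ ^+ l) a b c d =
  if [&& a == i, b == j, c == k & d == l] then 1 else 0.
Proof.
have hT : fT ^+ i = coef4 'X^i by rewrite coef4X fT_coef4.
have hU : fU ^+ j = coef4 ('X^j)%:P.
  by rewrite fU_coef4 -coef4X -[in LHS]polyC_exp.
have hV : fV ^+ k = coef4 ('X^k)%:P%:P.
  rewrite fV_coef4 -coef4X; congr coef4.
  exact: (etrans (esym (polyC_exp k _)) (congr1 polyC (esym (polyC_exp k _)))).
have hZ : fZ ^+ l = coef4 ('X^l)%:P%:P%:P.
  rewrite fZ_coef4 -coef4X; congr coef4.
  apply: (etrans (esym (polyC_exp l _)) (congr1 polyC _)).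
  exact: (etrans (esym (polyC_exp l _)) (congr1 polyC (esym (polyC_exp l _)))).
rewrite hT hU hV hZ -!fmulE -!coef4M /coef4 !coefMC !coefXn.
case: (a == i); last by rewrite mulr0n !(mul0r, coef0).
rewrite mulr1n !(mul1r, coefMC, coefXn).
case: (b == j); last by rewrite mulr0n !(mul0r, coef0).
rewrite mulr1n !(mul1r, coefMC, coefXn).
case: (c == k); last by rewrite mulr0n !(mul0r, coef0).
by rewrite mulr1n mul1r coefXn; case: (d == l).
Qed.

(** * Ascent sequences *)

Lemma asc_rcons s x : s != [::] -> asc (rcons s x) = (asc s + (last 0 s < x))%N.
Proof.
rewrite /asc; case: s => //= y s _; elim: s y => [|z s IHs] y //=.
  by rewrite addn0.
by rewrite IHs addnA.
Qed.

Lemma asc_lt_size s : s != [::] -> (asc s < size s)%N.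
Proof.
elim/last_ind: s => // s x IHs _; case: (eqVneq s [::]) => [->//|s0].
by rewrite asc_rcons // size_rcons; have := IHs s0; case: ltnP => _; lia.
Qed.

Lemma zeros_rcons s x : zeros (rcons s x) = (zeros s + (x == 0))%N.
Proof. by rewrite /zeros -cats1 count_cat /= addn0. Qed.

(** The bound on an entry involves only the prefix before it, so a new last letter adds a single
    condition. *)
Lemma is_ascent_rcons s x : s != [::] ->
  is_ascent (rcons s x) = is_ascent s && (x <= (asc s).+1)%N.
Proof.
case: s => // y s _; rewrite /is_ascent /= -andbA; congr (_ && _).
rewrite size_rcons -(addn1 (size s)) iotaD all_cat /= andbT.
rewrite nth_rcons ltnn eqxx -cats1 take_size_cat //; congr (_ && _).
apply: eq_in_all => i; rewrite mem_iota => /andP[i1 i2].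
case: i i1 i2 => // i _ i2 /=.
by rewrite nth_cat take_cat (_ : i < size s)%N //; lia.
Qed.

(* k is the number of entries after the initial 0^r 1. *)
Fixpoint ascseqs (r k : nat) : seq (seq nat) :=
  if k is k'.+1 then
    flatten [seq [seq rcons w x | x <- iota 0 (asc w).+2] | w <- ascseqs r k']
  else [:: rcons (nseq r 0%N) 1%N].

Lemma ascseqsS r k : ascseqs r k.+1 =
  flatten [seq [seq rcons w x | x <- iota 0 (asc w).+2] | w <- ascseqs r k].
Proof. by []. Qed.

Lemma last_nseq0 r : last 0%N (nseq r 0%N) = 0%N.
Proof. by elim: r. Qed.

Definition starts01 (r : nat) (s : seq nat) : bool :=
  all (fun i => nth 0%N s i == 0%N) (iota 0 r) && (nth 0%N s r == 1%N).

Lemma starts01_rcons r s x : (r < size s)%N ->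
  starts01 r (rcons s x) = starts01 r s.
Proof.
move=> rs; rewrite /starts01 nth_rcons rs; congr (_ && _).
apply: eq_in_all => i; rewrite mem_iota add0n => /andP[_ ir].
by rewrite nth_rcons (ltn_trans ir rs).
Qed.

Lemma asc_nseq r : asc (nseq r 0%N) = 0%N.
Proof. by rewrite /asc; elim: r => //= -[|r] //=. Qed.

Lemma is_ascent_nseq r : (0 < r)%N -> is_ascent (nseq r 0%N).
Proof.
by case: r => // r _; apply/and3P; split => //; apply/allP => i _; rewrite nth_nseq if_same.
Qed.

(** Induction on [k] by removing the last letter, which lies beyond the initial 0^r 1 once [k > 0];
    for [k = 0], the length and [starts01] fix every entry. *)
Lemma mem_ascseqs r k w : (0 < r)%N ->
  (w \in ascseqs r k) =
  [&& is_ascent w, size w == (r + k).+1 & starts01 r w].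
Proof.
move=> r0; elim: k w => [|k IHk] w.
  rewrite inE addn0; apply/eqP/and3P => [->|[_ /eqP sw /andP[w0 /eqP w1]]].
    rewrite is_ascent_rcons -?size_eq0 ?size_nseq -?lt0n // is_ascent_nseq //.
    rewrite asc_nseq size_rcons size_nseq eqxx; split => //.
    rewrite /starts01 nth_rcons size_nseq ltnn eqxx andbT.
    apply/allP => i; rewrite mem_iota add0n => /andP[_ ir].
    by rewrite nth_rcons size_nseq ir nth_nseq ir.
  apply: (@eq_from_nth _ 0%N); first by rewrite sw size_rcons size_nseq.
  move=> i; rewrite sw ltnS leq_eqVlt => /predU1P[->|ir].
    by rewrite w1 nth_rcons size_nseq ltnn eqxx.
  rewrite nth_rcons size_nseq ir nth_nseq ir; apply/eqP/(allP w0).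
  by rewrite mem_iota.
rewrite ascseqsS; apply/flatten_mapP/and3P => [[w' hw hx]|].
  case/mapP: hx => x hx ->.
  move: hw; rewrite IHk => /and3P[h1 /eqP h2 h3].
  have w0 : w' != [::] by rewrite -size_eq0 h2.
  rewrite is_ascent_rcons // h1 size_rcons h2 addnS eqxx starts01_rcons.
    by move: hx; rewrite mem_iota add0n.
  by rewrite h2 ltnS leq_addr.
case/lastP: w => [[] //|w x [h1]]; rewrite size_rcons addnS eqSS => /eqP h2.
have w0 : w != [::] by rewrite -size_eq0 h2.
rewrite starts01_rcons ?h2 ?ltnS ?leq_addr // => h3.
move: h1; rewrite is_ascent_rcons // => /andP[h1 hx].
exists w; first by rewrite IHk h1 h2 eqxx.
by apply: map_f; rewrite mem_iota add0n ltnS.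
Qed.

Lemma uniq_ascseqs r k : uniq (ascseqs r k).
Proof.
elim: k => // k IHk; rewrite ascseqsS; apply: allpairs_uniq_dep => //.
  by move=> w _; apply: iota_uniq.
by move=> [w x] [w' x'] _ _ /= /rcons_inj[<- <-].
Qed.

(** A new letter above the last one creates an ascent and exceeds the old number of ascents by at
    most one; any other letter is at most the old last entry. This bound lets [ascpolyS] cut the
    range of the new letter at the last entry. *)
Lemma ascseqs_last r k w : (0 < r)%N -> w \in ascseqs r k -> (last 0 w <= asc w)%N.
Proof.
move=> r0; elim: k w => [|k IHk] w.
  rewrite inE => /eqP->; rewrite last_rcons asc_rcons ?asc_nseq; last by case: r r0.
  by rewrite last_nseq0.
move=> hw'; have := hw'; rewrite mem_ascseqs // => /and3P[hw _ _].
case/flatten_mapP: hw' => w' hw' /mapP[x hx ->]; move: (hw').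
rewrite mem_ascseqs // => /and3P[_ /eqP h2 _].
have w0 : w' != [::] by rewrite -size_eq0 h2.
rewrite asc_rcons // last_rcons; have := IHk _ hw'.
by move: hx; rewrite mem_iota; case: ltnP => /=; lia.
Qed.

(** For [i > 0] the entry is at most one plus the ascents of a prefix of length [i], hence at most
    [i]. *)
Lemma is_ascent_nth_lt s i : is_ascent s -> (i < size s)%N -> (nth 0%N s i < size s)%N.
Proof.
case/and3P => s0 /eqP n0 /allP h hi'; case: i hi' => [|i] hi; first by rewrite n0; lia.
apply: leq_ltn_trans (h i.+1 _) _; first by rewrite mem_iota; lia.
have := @asc_lt_size (take i.+1 s); rewrite -size_eq0 size_take hi => /(_ isT).
lia.
Qed.

Lemma Gcoef_ascseqs r k a b c : (0 < r)%N ->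
  Gcoef r (r + k).+1 a b c =
  count (fun w => [&& asc w == a, last 0%N w == b & zeros w == c]) (ascseqs r k).
Proof.
move=> r0; set n := (r + k).+1; rewrite /Gcoef cardE -size_filter.
set E := enum _.
have <- : size (map (fun w : n.-tuple 'I_n => map (@nat_of_ord n) w) E) = size E.
  exact: size_map.
apply/perm_size/uniq_perm.
- rewrite map_inj_uniq ?enum_uniq // => w w' /inj_map h; apply/val_inj/h.
  exact: val_inj.
- exact/filter_uniq/uniq_ascseqs.
move=> w; rewrite mem_filter mem_ascseqs //; apply/mapP/andP => [[w' ]|].
  rewrite mem_enum inE => /and4P[h1 h2 h3] /and4P[h4 h5 h6 h7] ->.
  split; first by rewrite h5 h6 h7.
  by rewrite h1 size_map size_tuple eqxx /starts01 h3 h4.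
case=> /and3P[h5 h6 h7] /and3P[h1 /eqP h2 /andP[h3 h4]].
(* The default [ord0] is never returned, since every entry of [w] is below [n]. *)
have hw : map (@nat_of_ord n) (map (fun x => insubd (ord0 : 'I_n) x) w) = w.
  rewrite -map_comp; apply: map_id_in => x /(nthP 0%N) [i iw <-] /=.
  by rewrite val_insubd (_ : nth _ _ _ < n)%N // /n -h2 is_ascent_nth_lt.
have hs : size (map (fun x => insubd (ord0 : 'I_n) x) w) == n.
  by rewrite size_map h2.
exists (Tuple hs) => //=.
by rewrite mem_enum inE /Gpred /= hw h1 h2 h3 h4 h5 h6 h7 ltnS leq_addr.
Qed.

Lemma Gcoef_small r n a b c : (n <= r)%N -> Gcoef r n a b c = 0%N.
Proof.
move=> nr; apply: eq_card0 => w; rewrite inE /Gpred size_map size_tuple.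
by rewrite ltnNge nr /= andbF.
Qed.

(** * The functional equation *)

Section Recurrence.
Variables (A : comNzRingType) (r : nat) (t z : A).
Hypothesis r0 : (0 < r)%N.

(** The coefficient of t^(r+k+1) in G_r, evaluated in an arbitrary ring so that [u] and [v] can be
    specialised freely. *)
Definition ascpoly k (u v : A) : A :=
  \sum_(w <- ascseqs r k) u ^+ asc w * v ^+ last 0%N w * z ^+ zeros w.

Lemma ascpoly0 u v : ascpoly 0 u v = u * v * z ^+ r.
Proof.
rewrite /ascpoly big_seq1 asc_rcons; last by case: r r0.
rewrite last_rcons zeros_rcons asc_nseq /zeros count_nseq mul1n addn0 expr1.
by rewrite last_nseq0.
Qed.

(** Let [w] have [a] ascents and last entry [b]. Appending 0 adds a zero, 1..b adds nothing, and
    b+1..a+1 adds an ascent. The factor [v - 1] clears the two geometric sums; the top term u^(a+1)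
    v^(a+2) gives the evaluation at [u * v]. *)
Lemma ascpolyS k u v : (v - 1) * ascpoly k.+1 u v =
  (z * (v - 1) - v) * ascpoly k u 1 + v * ascpoly k u v
  + u * v * (v * ascpoly k (u * v) 1 - ascpoly k u v).
Proof.
rewrite /ascpoly ascseqsS big_flatten big_map !mulr_sumr -sumrB mulr_sumr -!big_split.
apply: eq_big_seq => w hw; rewrite big_map.
have w0 : w != [::].
  by move: hw; rewrite mem_ascseqs // => /and3P[]; case: w.
have la := ascseqs_last r0 hw.
under eq_bigr do rewrite asc_rcons // last_rcons zeros_rcons.
set a := asc w in la *; set b := last 0%N w in la *; set c := zeros w.
(* The three ranges of the new letter; [la] makes the last one have a - b + 1 elements. *)
have -> : iota 0 a.+2 = 0%N :: iota 1 b ++ iota b.+1 (a - b).+1.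
  by rewrite (_ : a.+2 = 1 + (b + (a - b).+1))%N ?iotaD //; lia.
rewrite big_cons big_cat ltn0 eqxx expr0 addn0 addn1 mulrDr mulrDr.
have geo m n : (v - 1) * (\sum_(x <- iota m n) v ^+ x) = v ^+ (m + n) - v ^+ m.
  elim: n m => [|n IHn] m /=; first by rewrite big_nil addn0 mulr0 subrr.
  by rewrite big_cons mulrDr IHn addnS exprS addSn !exprS; ring.
rewrite (eq_big_seq (fun x => (u ^+ a * z ^+ c) * v ^+ x)); last first.
  move=> x; rewrite mem_iota => h; rewrite (_ : (b < x)%N = false); last lia.
  by rewrite (_ : (x == 0)%N = false) ?addn0; [ring|lia].
rewrite [X in _ + (_ + _ * X)](eq_big_seq (fun x => (u ^+ a.+1 * z ^+ c) * v ^+ x)); last first.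
  move=> x; rewrite mem_iota => h; rewrite (_ : (b < x)%N = true); last lia.
  by rewrite (_ : (x == 0)%N = false) ?addn0 ?addn1; [ring|lia].
rewrite -!mulr_sumr !(mulrCA (v - 1) (_ * _)) !geo.
rewrite (_ : (b.+1 + (a - b).+1)%N = a.+2); last lia.
rewrite !expr1n exprMn add1n !exprS expr0 /=; ring.
Qed.

Definition ascsum n (u v : A) : A := \sum_(k < n) t ^+ (r + k).+1 * ascpoly k u v.

(** [ascpolyS] multiplied by t^(r+k+2) and summed telescopes: the lower end is the source term from
    0^r 1, the upper end is the error caused by bounding the lengths. *)
Lemma ascsum_eq n u v :
  (v * (u - (1 - t) * (u - 1)) - 1) * ascsum n u v =
  t ^+ r.+1 * z ^+ r * u * v * (v - 1) + (z * (v - 1) - v) * (t * ascsum n u 1)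
  + u * v ^+ 2 * (t * ascsum n (u * v) 1)
  - t ^+ (r + n).+1 * ((v - 1) * ascpoly n u v).
Proof.
elim: n => [|n IHn].
  by rewrite /ascsum !big_ord0 ascpoly0 addn0; ring.
rewrite ascpolyS addnS [t ^+ (r + n).+2]exprS.
rewrite /ascsum !big_ord_recr /= -/(ascsum n u v) -/(ascsum n u 1).
by rewrite -/(ascsum n (u * v) 1) [LHS]mulrDr IHn; ring.
Qed.

End Recurrence.

(** * The kernel method *)

Section Kernel.
Variables (A : comNzRingType) (r : nat) (t z y : A) (d g d' g' : nat -> A).
Hypothesis r0 : (0 < r)%N.
Hypothesis dE : forall s, d s = y - (1 - t) ^+ s * (y - 1).
Hypothesis gE : forall s, g s.+1 = y - (1 - z * t) * (1 - t) ^+ s * (y - 1).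
Hypothesis dV : forall s, d s * d' s = 1.
Hypothesis gV : forall s, g s.+1 * g' s.+1 = 1.

Let c := t * (t ^+ r.+1 * z ^+ r) * (y * (1 - y)).
(** The truncation of t G(y / d_s, 1); since d_0 = 1, [K n 0] is the wanted t G(y, 1). *)
Let K n s := t * ascsum r t z n (y * d' s) 1.

(* Evaluate [ascsum_eq] where its left-hand side vanishes: at u = y / d_s the
   kernel root is v = d_s / d_(s+1), and then u v = y / d_(s+1). *)
Lemma kernel_step n s : exists e,
  K n s * d' s = c * ((1 - t) ^+ s * (d' s * d' s.+1 * g' s.+1))
    + y * g' s.+1 * (K n s.+1 * d' s.+1) + t ^+ n * e.
Proof.
pose u := y * d' s; pose v := d s * d' s.+1.
have uv : u * v = y * d' s.+1.
  rewrite /u /v; transitivity (y * d' s.+1 * (d s * d' s)); first by ring.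
  by rewrite dV mulr1.
have ds : d s.+1 = (1 - t) * d s + t * y by rewrite !dE exprS; ring.
have v1 : v - 1 = t * (1 - t) ^+ s * (1 - y) * d' s.+1.
  transitivity (d s * d' s.+1 - d s.+1 * d' s.+1); first by rewrite (dV s.+1).
  by rewrite !dE exprS; ring.
have kv : v * (u - (1 - t) * (u - 1)) - 1 = 0.
  transitivity (t * (u * v) + (1 - t) * v - 1); first by ring.
  rewrite uv /v; transitivity (d s.+1 * d' s.+1 - 1); first by rewrite ds; ring.
  by rewrite dV subrr.
(* This is where gamma enters: the coefficient of G(u, 1) becomes -g_(s+1) / d_(s+1). *)
have gv : z * (v - 1) - v = - (g s.+1 * d' s.+1).
  by rewrite v1 /v gE dE; ring.
have := @ascsum_eq A r t z r0 n u v; rewrite kv mul0r uv gv.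
set P := ascpoly _ _ _ _ _; set a := t ^+ r.+1 * z ^+ r.
rewrite -/(K n s) -/(K n s.+1) addnC -addnS exprD => E.
have {}E : g s.+1 * d' s.+1 * K n s =
    a * (u * v) * (v - 1) + (u * v) * v * K n s.+1 - t ^+ n * (t ^+ r.+1 * ((v - 1) * P)).
  by rewrite -[LHS]add0r {1}E; ring.
rewrite uv v1 in E; set X := t ^+ r.+1 * _ in E.
(* [F] cancels the coefficient of [K n s] and divides by d_s. After this normalisation the next term
   carries just the factor y / g_(s+1), so that iteration yields a plain product. *)
pose F := d s.+1 * g' s.+1 * d' s.
have -> : K n s * d' s = F * (g s.+1 * d' s.+1 * K n s).
  transitivity (d s.+1 * d' s.+1 * (g s.+1 * g' s.+1) * (K n s * d' s)).
    by rewrite dV gV !mul1r.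
  by rewrite /F; ring.
exists (- (F * X)); rewrite E /F /v /c -/a.
(* The products [d * d'] stay visible so that [ring] can match the two forms without knowing about
   inverses; [dV] then removes them. *)
transitivity (
  d s.+1 * d' s.+1 *
    (t * a * (y * (1 - y)) * ((1 - t) ^+ s * (d' s * d' s.+1 * g' s.+1)))
  + (d s.+1 * d' s.+1) * (d s * d' s) * (y * g' s.+1 * (K n s.+1 * d' s.+1))
  - t ^+ n * (d s.+1 * g' s.+1 * d' s * X)); first by ring.
by rewrite !dV; ring.
Qed.

(** Unrolling [kernel_step] from 0 to [N] collects the powers of [y] and the product of the inverses
    of the g_i. *)
Lemma kernel_iter n N : exists e1 e2,
  K n 0 = c * (\sum_(s < N) y ^+ s * (1 - t) ^+ s *
                 (d' s * d' s.+1 * \prod_(1 <= i < s.+2) g' i))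
    + y ^+ N * e1 + t ^+ n * e2.
Proof.
have d0 : d 0 = 1 by rewrite dE expr0; ring.
have d'0 : d' 0 = 1 by rewrite -(dV 0) d0 mul1r.
(* The remainder must stay explicit in the induction, because [kernel_step] is applied to it. *)
suff [e2 E] : exists e2, K n 0 * d' 0 =
    c * (\sum_(s < N) y ^+ s * (1 - t) ^+ s *
                 (d' s * d' s.+1 * \prod_(1 <= i < s.+2) g' i))
    + y ^+ N * \prod_(1 <= i < N.+1) g' i * (K n N * d' N) + t ^+ n * e2.
  exists (\prod_(1 <= i < N.+1) g' i * (K n N * d' N)), e2.
  by rewrite -[LHS]mulr1 -[1 in LHS]d'0 E !mulrA.
elim: N => [|N [e2 ->]].
  by exists 0; rewrite big_ord0 big_geq // expr0; ring.
have [e ->] := kernel_step n N.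
exists (e2 + y ^+ N * \prod_(1 <= i < N.+1) g' i * e).
rewrite big_ord_recr /= [\prod_(1 <= i < N.+2) _]big_nat_recr //= exprS.
by ring.
Qed.

End Kernel.

(** * Summation *)

Definition ccoef (f : fps) : rat := f 0%N 0%N 0%N 0%N.

Lemma ccoefM (f g : fps) : ccoef (f * g) = ccoef f * ccoef g.
Proof. by rewrite /ccoef -fmulE /fmul !big_ord1. Qed.

Lemma ccoefX (f : fps) n : ccoef (f ^+ n) = ccoef f ^+ n.
Proof. by elim: n => // n IHn; rewrite !exprS ccoefM IHn. Qed.

Lemma ccoefD (f g : fps) : ccoef (f + g) = ccoef f + ccoef g.
Proof. by []. Qed.

Lemma ccoefN (f : fps) : ccoef (- f) = - ccoef f.
Proof. by []. Qed.

Lemma ccoef_1 : ccoef 1 = 1. Proof. by []. Qed.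
Lemma ccoefT : ccoef fT = 0. Proof. by []. Qed.
Lemma ccoefU : ccoef fU = 0. Proof. by []. Qed.
Lemma ccoefV : ccoef fV = 0. Proof. by []. Qed.
Lemma ccoefZ : ccoef fZ = 0. Proof. by []. Qed.

Lemma ccoefUV : ccoef (fU * fV) = 0.
Proof. by rewrite ccoefM mul0r. Qed.

Definition ccoefE :=
  (ccoefM, ccoefX, ccoefD, ccoefN, ccoef_1, ccoefT, ccoefU, ccoefV, ccoefZ).

Lemma fps_mulfV (f : fps) : ccoef f != 0 -> f * Defs.finv f = 1.
Proof. by move=> f0; rewrite mulrC fps_mulVf. Qed.

Lemma finv_uniq (f g : fps) : ccoef f != 0 -> f * g = 1 -> Defs.finv f = g.
Proof. by move=> f0 fg; rewrite -[LHS]mulr1 -fg mulrA fps_mulVf // mul1r. Qed.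

Lemma fprodE F a n : Defs.fprod F a n = \prod_(a <= i < a + n) F i.
Proof.
rewrite /Defs.fprod /index_iota addKn; elim: n a => [|n IHn] a.
  by rewrite big_nil.
by rewrite big_cons /= IHn.
Qed.

(* Common form of the two sums: y = u for termA and y = u v for termB. *)
Section Summand.
Variable y : fps.
Hypothesis y0 : ccoef y = 0.

Definition del s : fps := y - (1 - fT) ^+ s * (y - 1).
Definition gam s : fps :=
  if s is s'.+1 then y - (1 - fZ * fT) * (1 - fT) ^+ s' * (y - 1) else 1.
Definition summand s : fps :=
  y ^+ s * (1 - fT) ^+ s * (Defs.finv (del s) * Defs.finv (del s.+1) *
    \prod_(1 <= i < s.+2) Defs.finv (gam i)).

Lemma ccoef_del s : ccoef (del s) = 1.
Proof. by rewrite /del !ccoefE y0 subr0 expr1n !sub0r mul1r opprK. Qed.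

Lemma ccoef_gam s : ccoef (gam s) = 1.
Proof.
case: s => //= s.
by rewrite !ccoefE y0 mulr0 subr0 expr1n !sub0r !mul1r opprK.
Qed.

Lemma delV s : del s * Defs.finv (del s) = 1.
Proof. by apply: fps_mulfV; rewrite ccoef_del. Qed.

Lemma gamV s : gam s * Defs.finv (gam s) = 1.
Proof. by apply: fps_mulfV; rewrite ccoef_gam. Qed.

(** By uniqueness of inverses, the inverse of the denominator is the product of the separate
    inverses, which is the shape produced by [kernel_iter]. *)
Lemma summandE s :
  fdiv (y ^+ s * (1 - fT) ^+ s) (del s * del s.+1 * Defs.fprod gam 1 s.+1) =
  summand s.
Proof.
rewrite /fdiv fmulE; congr (_ * _); rewrite fprodE add1n.
apply: finv_uniq.
  rewrite !ccoefM !ccoef_del !mul1r.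
  by rewrite (big_morph _ ccoefM ccoef_1) big1 ?oner_eq0 // => i _; rewrite ccoef_gam.
rewrite mulrACA (mulrACA (del s)) !delV !mul1r -big_split /=.
by rewrite big1 // => i _; rewrite gamV.
Qed.

Lemma ford_y : ford 1 y.
Proof. by move=> [|//] [|//] [|//] [|//] _. Qed.

Lemma ford_summand s : ford s (summand s).
Proof. by apply: fordMr; apply: fordMr; apply/fordX/ford_y. Qed.

End Summand.

(** At [s = 0] the general formula reads u - (u - 1) = 1, the value set apart in [delta]. *)
Lemma deltaE : delta = del fU.
Proof.
apply/funext => -[|s]; first by rewrite /del expr0 mul1r subKr.
by rewrite /del -fexpE.
Qed.

Lemma gammaE : gamma = gam fU.
Proof. by apply/funext => -[|s] //; rewrite /gam -fexpE. Qed.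

Lemma termAE : termA = summand fU.
Proof.
apply/funext => s; rewrite -(summandE ccoefU).
by rewrite -deltaE -gammaE -(fexpE _ s) -(fexpE _ s).
Qed.

Lemma dbarE : dbar = del (fU * fV).
Proof.
apply/funext => -[|s]; first by rewrite /del expr0 mul1r subKr.
by rewrite /del -fexpE.
Qed.

Lemma gbarE : gbar = gam (fU * fV).
Proof. by apply/funext => -[|s] //; rewrite /gam -fexpE. Qed.

Lemma termBE : termB = summand (fU * fV).
Proof.
apply/funext => s; rewrite -(summandE ccoefUV).
by rewrite -dbarE -gbarE -(fexpE _ s) -(fexpE _ s).
Qed.

(** Each coefficient receives contributions only from indices up to its total degree, so the sum can
    be defined coefficientwise; the second conjunct bounds the tails. *)
Lemma fsum_to_ex (F : nat -> fps) : (forall s, ford s (F s)) ->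
  exists S, fsum_to F S /\ forall n, ford n (S - \sum_(s < n) F s).
Proof.
move=> hF; pose S : fps := fun i j k l => \sum_(s < (i + j + k + l).+1) F s i j k l.
have hS n i j k l : (i + j + k + l < n)%N -> \sum_(s < n) F s i j k l = S i j k l.
  move=> hn; rewrite /S [RHS](big_ord_widen n (fun s => F s i j k l)) //.
  rewrite [LHS](bigID (fun s : 'I_n => (s < (i + j + k + l).+1)%N)) /=.
  by rewrite [X in _ + X]big1 ?addr0 // => s; rewrite -ltnNge ltnS; apply: hF.
exists S; split=> [i j k l|n i j k l hn]; first by exists (i + j + k + l).+1 => n; apply: hS.
by rewrite coef_fpsD coef_fpsN coef_fps_sum hS // subrr.
Qed.

(** A coefficient of total degree below [n] concerns sequences of length below [n], all of which
    [ascsum] includes. *)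
Lemma ford_G r n : (0 < r)%N -> ford n (G r - ascsum r fT fZ n fU fV).
Proof.
move=> r0 i a b c hn; rewrite /ascsum coef_fpsD coef_fpsN coef_fps_sum.
have E m : (fT ^+ (r + m).+1 * ascpoly r fZ m fU fV) i a b c =
    if i == (r + m).+1 then
      (count (fun w => [&& asc w == a, last 0%N w == b & zeros w == c])
        (ascseqs r m))%:R else 0.
  rewrite /ascpoly mulr_sumr coef_fps_sum.
  under eq_bigr do rewrite !mulrA coef_monom.
  case: eqP => _ /=; last by rewrite big1.
  rewrite -sum1_count natr_sum [RHS]big_mkcond /=; apply: eq_bigr => w _.
  by rewrite (eq_sym a) (eq_sym b) (eq_sym c).
under eq_bigr do rewrite E.
(* Lengths up to [r] contribute nothing on either side; a longer length [i] occurs for exactly one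
   index, i - r - 1. *)
have [ir|ri] := leqP i r.
  rewrite /G Gcoef_small // big1 ?subrr // => m _; case: eqP => //; lia.
have hm : (i - r.+1 < n)%N by lia.
rewrite (bigD1 (Ordinal hm)) //= big1 ?addr0; last first.
  move=> m; rewrite -val_eqE /= => hmi; case: eqP => // im.
  by exfalso; move: hmi; rewrite im; lia.
have ei : i = (r + (i - r.+1)).+1 by lia.
by rewrite -ei eqxx /G {1}ei Gcoef_ascseqs // subrr.
Qed.

Theorem theorem3 (r : nat) (hr : (1 <= r)%N) :
  exists S1 S2 : fps,
    fsum_to termA S1 /\ fsum_to termB S2 /\ G r = Grhs r S1 S2.
Proof.
rewrite termAE termBE.
have [S1 [hS1 S1E]] := fsum_to_ex (ford_summand ccoefU).
have [S2 [hS2 S2E]] := fsum_to_ex (ford_summand ccoefUV).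
exists S1, S2; split => //; split => //.
(* [X] is v delta_1 - 1, with constant term -1, and [B] is the right-hand side multiplied by it. *)
pose X : fps := fV * (fU - (1 - fT) * (fU - 1)) - 1.
pose B : fps := fT ^+ r.+1 * fZ ^+ r * fU * (fV * (fV - 1)
  + fT * (1 - fU) * (fZ * (fV - 1) - fV) * S1
  + fU * fV ^+ 3 * fT * (1 - fU * fV) * S2).
have X0 : ccoef X != 0.
  by rewrite /X !ccoefE.
have -> : Grhs r S1 S2 = Defs.finv X * B.
  have XE : fV * del fU 1 - 1 = X by rewrite /del expr1.
  rewrite /Grhs /fdiv deltaE !fexpE !fmulE !fsubE !faddE foneE XE /B.
  ring.
suff <- : X * G r = B by rewrite mulrA fps_mulVf // mul1r.
apply: eq_ford => n.
(* The closed form of t G(y, 1) up to order [n]. Taking n kernel steps as well as n lengths makes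
   both errors, multiples of y^n and t^n, have order [n]. *)
have tail (y : fps) : ccoef y = 0 -> exists2 h, ford n h &
    fT * ascsum r fT fZ n y 1 =
    fT * (fT ^+ r.+1 * fZ ^+ r) * (y * (1 - y)) * (\sum_(s < n) summand y s) + h.
  move=> y0.
  have [e1 [e2]] := @kernel_iter _ r fT fZ y (del y) (gam y)
    (fun s => Defs.finv (del y s)) (fun s => Defs.finv (gam y s)) hr
    (fun s => erefl) (fun s => erefl) (delV y0) (fun s => gamV y0 s.+1) n n.
  have -> : Defs.finv (del y 0) = 1.
    rewrite -[LHS]mul1r -[RHS](delV y0 0); congr (_ * _).
    by rewrite /del expr0; ring.
  rewrite mulr1 => ->; exists (y ^+ n * e1 + fT ^+ n * e2); last by rewrite addrA.
  by apply: fordD; apply/fordMr/fordX/ford_y.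
have [h1 h1n E1] := tail _ ccoefU.
have [h2 h2n E2] := tail _ ccoefUV.
have E := ascsum_eq fT fZ hr n fU fV.
rewrite E1 E2 -/X in E.
(* Four errors of order [n]: the truncation of G, the kernel remainder with the tail of the series
   for y = u, the same for y = uv, and the boundary term of [ascsum_eq]. *)
have -> : X * G r - B = (G r - ascsum r fT fZ n fU fV) * X
  + ((h1 - (S1 - \sum_(s < n) summand fU s) *
          (fT * (fT ^+ r.+1 * fZ ^+ r) * (fU * (1 - fU)))) * (fZ * (fV - 1) - fV)
  + ((h2 - (S2 - \sum_(s < n) summand (fU * fV) s) *
          (fT * (fT ^+ r.+1 * fZ ^+ r) * (fU * fV * (1 - fU * fV)))) * (fU * fV ^+ 2)
  - fT ^+ n * (fT ^+ r.+1 * ((fV - 1) * ascpoly r fZ n fU fV)))).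
  rewrite [(_ - ascsum _ _ _ _ _ _) * X]mulrBl [ascsum _ _ _ _ _ _ * X]mulrC E.
  rewrite -[(r + n).+1]addSn exprD /B.
  ring.
apply: fordD; first exact/fordMr/ford_G.
apply: fordD; first by apply/fordMr/fordD => //; apply/fordN/fordMr.
apply: fordD; first by apply/fordMr/fordD => //; apply/fordN/fordMr.
by apply/fordN/fordMr/fordX/ford_y.
Qed.
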